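(* Let $\Gamma$ be a discrete cocompact torsion-free lattice in $SL(n,\mathbb{C})$, $n\ge 2$. Then $\mathbb{C}\Gamma$ contains no nontrivial idempotents (i.e. no idempotents other than $0$ and $1$).
   Context: $\mathbb{C}\Gamma$ is the complex group algebra of $\Gamma$. *)

(* Defs.v *)
From HB Require Import structures.
From mathcomp Require Import all_boot all_order all_algebra all_fingroup.
From mathcomp Require Import finmap.
From mathcomp Require Import all_classical all_reals topology.
From mathcomp Require Import complex.

Set Implicit Arguments.
Unset Strict Implicit.
Unset Printing Implicit Defensive.

Import Order.TTheory GRing.Theory Num.Theory.
Import numFieldTopology.Exports.

Local Open Scope classical_set_scope.
Local Open Scope quotient_scope.
Local Open Scope ring_scope.

(* Finitely supported functions G -> K, i.e. formal finite sums
   \sum_x f x x, with the convolution product [ga_mul]. *)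
Definition group_algebra (K : comNzRingType) (G : groupType) : Type :=
  {fsfun G -> K with 0}.

HB.instance Definition _ (K : comNzRingType) (G : groupType) :=
  Choice.on (group_algebra K G).

Section GroupAlgebra.
Variables (K : comNzRingType) (G : groupType).
Local Notation KG := (group_algebra K G).
Implicit Types (a b : K) (f g h : KG) (x y z : G).

Definition ga_coef f : G -> K := fun_of_fsfun f.
Local Coercion ga_coef : group_algebra >-> Funclass.
Definition ga_supp f : {fset G} := finsupp f.

Definition ga_of (S : {fset G}) (F : G -> K) : KG := [fsfun x in S => F x].

Lemma ga_ofE S F x : (x \notin S -> F x = 0) -> ga_of S F x = F x.
Proof. by move=> F0; rewrite [LHS]fsfunE; case: ifPn => // /F0 ->. Qed.

Lemma ga_P f g : (forall x, f x = g x) -> f = g.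
Proof. by move=> fg; apply/fsfunP. Qed.

Lemma ga_notin f x : x \notin ga_supp f -> f x = 0.
Proof. exact: fsfun_dflt. Qed.

Definition ga_zero : KG := ga_of fset0 (fun=> 0).
Definition ga_opp f : KG := ga_of (ga_supp f) (fun x => - f x).
Definition ga_add f g : KG :=
  ga_of (ga_supp f `|` ga_supp g)%fset (fun x => f x + g x).
Definition ga_scale a f : KG := ga_of (ga_supp f) (fun x => a * f x).
Definition ga_one : KG := ga_of [fset 1%g]%fset (fun x => (x == 1%g)%:R).

Definition ga_mul f g : KG :=
  ga_of [fset (y * z)%g | y in ga_supp f, z in ga_supp g]%fset
        (fun x => \sum_(y <- ga_supp f) f y * g (y^-1 * x)%g).

Lemma ga_zeroE x : ga_zero x = 0. Proof. exact: ga_ofE. Qed.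
Lemma ga_oppE f x : ga_opp f x = - f x.
Proof. by apply: ga_ofE => /ga_notin ->; rewrite oppr0. Qed.
Lemma ga_addE f g x : ga_add f g x = f x + g x.
Proof.
apply: ga_ofE; rewrite in_fsetU negb_or => /andP[].
by move=> /ga_notin -> /ga_notin ->; rewrite addr0.
Qed.
Lemma ga_scaleE a f x : ga_scale a f x = a * f x.
Proof. by apply: ga_ofE => /ga_notin ->; rewrite mulr0. Qed.
Lemma ga_oneE x : ga_one x = (x == 1%g)%:R.
Proof. by apply: ga_ofE; rewrite in_fset1 => /negPf ->. Qed.

Lemma ga_mulE f g x :
  ga_mul f g x = \sum_(y <- ga_supp f) f y * g (y^-1 * x)%g.
Proof.
apply: ga_ofE => xNfg; apply: big1_fset => y yf _.
rewrite (@ga_notin g) ?mulr0 //; apply: contra xNfg => yxg.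
by apply/imfset2P; exists y => //=; exists (y^-1 * x)%g; rewrite //= mulVKg.
Qed.

Lemma ga_mul_widen (S : {fset G}) f g x : {subset ga_supp f <= S} ->
  ga_mul f g x = \sum_(y <- S) f y * g (y^-1 * x)%g.
Proof.
move=> /fsubsetP fS; rewrite ga_mulE; apply: (big_fset_incl _ fS) => y _.
by move=> /ga_notin ->; rewrite mul0r.
Qed.

Lemma ga_addA : associative ga_add.
Proof. by move=> f g h; apply: ga_P => x; rewrite !ga_addE addrA. Qed.
Lemma ga_addC : commutative ga_add.
Proof. by move=> f g; apply: ga_P => x; rewrite !ga_addE addrC. Qed.
Lemma ga_add0 : left_id ga_zero ga_add.
Proof. by move=> f; apply: ga_P => x; rewrite !ga_addE ga_zeroE add0r. Qed.
Lemma ga_addN : left_inverse ga_zero ga_opp ga_add.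
Proof.
by move=> f; apply: ga_P => x; rewrite !ga_addE ga_zeroE ga_oppE addNr.
Qed.

HB.instance Definition _ :=
  GRing.isZmodule.Build KG ga_addA ga_addC ga_add0 ga_addN.

Lemma ga_mulA : associative ga_mul.
Proof.
move=> f g h; apply: ga_P => x; pose S := 
  [fset (y * z)%g | y in ga_supp f, z in ga_supp g]%fset.
have fgS : {subset ga_supp (ga_mul f g) <= S}.
  move=> y; apply: contraLR => yS; rewrite mem_finsupp negbK.
  by rewrite [X in X == _]fsfunE (negPf yS).
rewrite (ga_mul_widen _ _ fgS) ga_mulE.
under [RHS]eq_bigr do rewrite ga_mulE mulr_suml.
rewrite exchange_big /=; apply: eq_fbigr => z zf _.
rewrite ga_mulE mulr_sumr.
pose zg := [fset (z * y)%g | y in ga_supp g]%fset.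
rewrite -[RHS](@big_fset_incl _ _ _ _ zg); first last.
- move=> y _ yzg; rewrite (@ga_notin g) ?mulr0 ?mul0r //.
  apply: contra yzg => yg; apply/imfsetP.
  by exists (z^-1 * y)%g; rewrite //= mulVKg.
- apply/fsubsetP => _ /imfsetP[y /= yg ->].
  by apply/imfset2P; exists z => //=; exists y.
rewrite big_imfset /=; last by move=> y y' _ _ /mulgI.
by apply: eq_bigr => y _; rewrite mulKg mulrA invgM mulgA.
Qed.

Lemma ga_mul1l : left_id ga_one ga_mul.
Proof.
move=> f; apply: ga_P => x; rewrite (@ga_mul_widen [fset 1%g]%fset).
  by rewrite big_seq_fset1 ga_oneE eqxx mul1r invg1 mul1g.
move=> y; apply: contraLR; rewrite in_fset1 mem_finsupp negbK => yN1.
by rewrite [X in X == _]ga_oneE (negPf yN1).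
Qed.

Lemma ga_mul1r : right_id ga_one ga_mul.
Proof.
move=> f; apply: ga_P => x.
rewrite (@ga_mul_widen (x |` ga_supp f)%fset); last first.
  by move=> y yf; rewrite in_fsetU yf orbT.
rewrite (big_fsetD1 x) ?fset1U1 //= big1_fset ?addr0.
  by rewrite mulVg ga_oneE eqxx mulr1.
move=> y; rewrite !inE => /andP[yx _] _; rewrite ga_oneE.
by rewrite -(inj_eq (@mulgI _ y)) mulVKg mulg1 eq_sym (negPf yx) mulr0.
Qed.

Lemma ga_mulDl : left_distributive ga_mul ga_add.
Proof.
move=> f g h; apply: ga_P => x; pose S := (ga_supp f `|` ga_supp g)%fset.
rewrite ga_addE !(@ga_mul_widen S) -?big_split /=.
- by apply: eq_bigr => y _; rewrite ga_addE mulrDl.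
- by move=> y yg; rewrite in_fsetU yg orbT.
- by move=> y yf; rewrite in_fsetU yf.
move=> y; apply: contraLR => yS; rewrite mem_finsupp negbK.
by rewrite [X in X == _]fsfunE (negPf yS).
Qed.

Lemma ga_mulDr : right_distributive ga_mul ga_add.
Proof.
move=> f g h; apply: ga_P => x; rewrite ga_addE !ga_mulE -big_split /=.
by apply: eq_bigr => y _; rewrite ga_addE mulrDr.
Qed.

Lemma ga_one_neq0 : ga_one != 0.
Proof.
apply/eqP => /(congr1 (fun f : KG => f 1%g)) /eqP.
by rewrite ga_oneE ga_zeroE eqxx oner_eq0.
Qed.

HB.instance Definition _ := GRing.Zmodule_isNzRing.Build KG
  ga_mulA ga_mul1l ga_mul1r ga_mulDl ga_mulDr ga_one_neq0.

Lemma ga_scaleA a b f : ga_scale a (ga_scale b f) = ga_scale (a * b) f.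
Proof. by apply: ga_P => x; rewrite !ga_scaleE mulrA. Qed.
Lemma ga_scale1 : left_id 1 ga_scale.
Proof. by move=> f; apply: ga_P => x; rewrite ga_scaleE mul1r. Qed.
Lemma ga_scaleDr : right_distributive ga_scale +%R.
Proof.
by move=> a f g; apply: ga_P => x; rewrite !(ga_addE, ga_scaleE) mulrDr.
Qed.
Lemma ga_scaleDl f : {morph ga_scale^~ f : a b / a + b}.
Proof.
by move=> a b; apply: ga_P => x; rewrite !(ga_addE, ga_scaleE) mulrDl.
Qed.

HB.instance Definition _ := GRing.Zmodule_isLmodule.Build K KG
  ga_scaleA ga_scale1 ga_scaleDr ga_scaleDl.

Lemma ga_scaleAl a f g : a *: (f * g) = a *: f * g.
Proof.
apply: ga_P => x; rewrite ga_scaleE ga_mulE (@ga_mul_widen (ga_supp f)).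
  by rewrite mulr_sumr; apply: eq_bigr => y _; rewrite ga_scaleE mulrA.
move=> y; apply: contraLR => yS; rewrite mem_finsupp negbK.
by rewrite [X in X == _]fsfunE (negPf yS).
Qed.

HB.instance Definition _ :=
  GRing.Lmodule_isLalgebra.Build K KG ga_scaleAl.

Lemma ga_scaleAr a f g : a *: (f * g) = f * (a *: g).
Proof.
apply: ga_P => x; rewrite ga_scaleE !ga_mulE mulr_sumr.
by apply: eq_bigr => y _; rewrite ga_scaleE mulrCA.
Qed.

HB.instance Definition _ :=
  GRing.Lalgebra_isAlgebra.Build K KG ga_scaleAr.

End GroupAlgebra.

Record special_linear (n : nat) (K : comUnitRingType) := SpecialLinear {
  SLval :> 'M[K]_n;
  _ : \det SLval == 1
}.

Section SpecialLinear.
Variables (n : nat) (K : comUnitRingType).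
Local Notation SL := (special_linear n K).
Implicit Types A B : SL.

HB.instance Definition _ := [isSub for @SLval n K].
HB.instance Definition _ := [Choice of SL by <:].

Lemma det_SL A : \det A = 1. Proof. exact/eqP/(valP A). Qed.

Fact SL_one_subproof : \det (1%:M : 'M[K]_n) == 1.
Proof. by rewrite det1. Qed.
Fact SL_mul_subproof A B : \det (A *m B) == 1.
Proof. by rewrite det_mulmx !det_SL mulr1. Qed.
Fact SL_inv_subproof A : \det (invmx A) == 1.
Proof. by rewrite det_inv det_SL invr1. Qed.

Definition SL_one : SL := SpecialLinear SL_one_subproof.
Definition SL_mul A B : SL := SpecialLinear (SL_mul_subproof A B).
Definition SL_inv A : SL := SpecialLinear (SL_inv_subproof A).

Lemma SL_unitmx A : (A : 'M_n) \in unitmx.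
Proof. by rewrite unitmxE det_SL unitr1. Qed.

Lemma SL_mulA : associative SL_mul.
Proof. by move=> A B C; apply: val_inj; apply: mulmxA. Qed.
Lemma SL_mul1g : left_id SL_one SL_mul.
Proof. by move=> A; apply: val_inj; apply: mul1mx. Qed.
Lemma SL_mulg1 : right_id SL_one SL_mul.
Proof. by move=> A; apply: val_inj; apply: mulmx1. Qed.
Lemma SL_mulVg : left_inverse SL_one SL_inv SL_mul.
Proof. by move=> A; apply: val_inj; apply: (mulVmx (SL_unitmx A)). Qed.
Lemma SL_mulgV : right_inverse SL_one SL_inv SL_mul.
Proof. by move=> A; apply: val_inj; apply: (mulmxV (SL_unitmx A)). Qed.

HB.instance Definition _ :=
  isGroup.Build SL SL_mulA SL_mul1g SL_mulg1 SL_mulVg SL_mulgV.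

End SpecialLinear.

(* The topology induced from 'M[K]_n, itself the product topology for the
   topology of K given by its absolute value; for K := R[i] with R : realType
   this is the usual topology of SL(n, C). *)
HB.instance Definition _ (n : nat) (K : numFieldType) :=
  Topological.copy (special_linear n K)
    (initial_topology (@SLval n K : _ -> 'M[K]_n)).

Section Subgroups.
Variables (G : groupType) (H : groupClosed G).

Definition subgroup_type : Type := {x : G | x \in H}.
HB.instance Definition _ := SubChoice.on subgroup_type.

Fact subgroup_closed : group_closed H.
Proof. by split; [exact: gpred1 | exact: gpredF]. Qed.
HB.instance Definition _ :=
  SubChoice_isSubGroup.Build G (mem H) subgroup_type subgroup_closed.

(* x H = y H iff x^-1 y is in H, so the quotient below is G / H. *)
Definition left_coset_rel (x y : G) : bool := (x^-1 * y)%g \in H.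

Lemma left_coset_refl : reflexive left_coset_rel.
Proof. by move=> x; rewrite /left_coset_rel mulVg gpred1. Qed.
Lemma left_coset_sym : symmetric left_coset_rel.
Proof. by move=> x y; rewrite /left_coset_rel -gpredV invgM invgK. Qed.
Lemma left_coset_trans : transitive left_coset_rel.
Proof.
move=> y x z xy yz; rewrite /left_coset_rel.
by rewrite -[z](mulVKg y) mulgA gpredM.
Qed.

Canonical left_coset_equiv :=
  EquivRel left_coset_rel left_coset_refl left_coset_sym left_coset_trans.

Definition left_cosets : quotType G := {eq_quot left_coset_rel}.

End Subgroups.

Definition torsion_free (G : groupType) : Prop :=
  forall (x : G) (k : nat), (0 < k)%N -> (x ^+ k)%g = 1%g -> x = 1%g.

Section Lattices.
Variables (n : nat) (K : numFieldType).
Variable H : groupClosed (special_linear n K).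

(* A cocompact lattice is a discrete subgroup H with G / H compact; such a
   subgroup automatically has finite covolume, so no Haar measure is needed. *)
Definition discrete_subgroup : Prop := [set` H] `<=` isolated [set` H].

(* The quotient is not assumed Hausdorff: [compact] here is the covering
   (cluster point) property of G / H with its quotient topology. *)
Definition cocompact_subgroup : Prop :=
  compact [set: quotient_topology (left_cosets H)].

End Lattices.

(* Main.v *)
Require Import Defs.
From HB Require Import structures.
From mathcomp Require Import all_boot all_order all_algebra all_fingroup.
From mathcomp Require Import all_classical all_reals topology.
From mathcomp Require Import complex.
From mathcomp Require Import normedtype finmap cyclic closed_field spectral
  ring lra zify.

Set Implicit Arguments.
Unset Strict Implicit.
Unset Printing Implicit Defensive.

Import Order.TTheory GRing.Theory Num.Theory.
Import numFieldNormedType.Exports.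
Local Open Scope ring_scope.

(** Torsion-freeness alone is not known to rule out idempotents; the lattice
    satisfies something stronger, which does: no element x <> 1 is conjugate
    to a proper power x ^+ q, q > 1 ([lattice_power_conjugate_trivial]). If x
    is conjugate to x ^+ q, then raising to the power q maps the finite set of
    eigenvalues of x to itself; so they are roots of unity, and some power u =
    x ^+ m, m > 0, is unipotent. Conjugating a triangular form of u by
    diagonal matrices of determinant 1 brings u as close to 1 as desired.
    Since the lattice is cocompact, the conjugating matrices may be replaced
    by lattice elements, and discreteness gives u = 1. Finally x = 1, as the
    lattice is torsion free.

    For a group G with this property let e be an idempotent of CG, with
    coefficients e_g.

    First, e_1 is 0 or 1 ([idempotent_coef1]). Over a ring of characteristic p
    the sum t_c(f) of the coefficients of f over a conjugacy class c satisfies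
    t_c(f ^+ p) = (sum of the f_x with x ^+ p in c) ^+ p, because the
    non-constant p-tuples of group elements are permuted in orbits of length p
    by rotation. If f is idempotent and t_c(f) <> 0, this produces a class c'
    in the support of f with t_c'(f) <> 0 whose p-th power is c. The support
    being finite, the chain of such classes cycles, so a member of the cycle
    is conjugate to a proper power of itself; it is trivial, hence so is c.
    This descends to C: the relations expressing that e is idempotent involve
    finitely many complex numbers, and these can be specialized to a field of
    positive characteristic without killing a given nonzero t_c(e)
    ([generators_good_specializations]). Therefore the class sums of e vanish
    away from 1, and e_1 equals the augmentation of e, which is an idempotent
    of C.

    Second, e_1 = 0 implies e = 0 ([idempotent_trace0]), a theorem of
    Kaplansky; applied to 1 - e it settles the case e_1 = 1. With s the
    adjoint of e, the element z = 1 + (e - s)^* (e - s) is positive and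
    bounded below by 1, and e s z^-1 is the orthogonal projection onto the
    image of e, with the same trace as e; that trace is at least a positive
    multiple of the squared norm of e. As z need not be invertible in CG, its
    inverse is approximated by a geometric series in M - z, where M is an
    upper bound of z. *)

(** * Specializing complex numbers to positive characteristic *)

(** The image of [alpha] stands for a finitely generated subring of [K]:
    presenting it as a quotient of an iterated polynomial ring lets it grow
    one generator at a time without forming subrings of [K]. The condition on
    kernels says that [phi] factors through that image, so the image has
    enough points in positive characteristic to detect each of its nonzero
    elements. *)
Definition good_specializations (K : fieldType) (A : comNzRingType)
    (alpha : {rmorphism A -> K}) : Prop :=
  forall s, alpha s != 0 ->
  exists (p : nat) (L : closedFieldType) (phi : {rmorphism A -> L}),
    [/\ p \in [pchar L], phi s != 0 & forall x, alpha x = 0 -> phi x = 0].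

Definition eval_at (A S : comNzRingType) (phi : {rmorphism A -> S}) (b : S) :
    {rmorphism {poly A} -> S} :=
  horner_morph (fun x => mulrC b (phi x)).

Lemma eval_atE (A S : comNzRingType) (phi : {rmorphism A -> S}) b f :
  eval_at phi b f = (map_poly phi f).[b].
Proof. by []. Qed.

Lemma intr_eq0_absz (K : fieldType) (x : int) :
  (x%:~R == 0 :> K) = (`|x|%N%:R == 0 :> K).
Proof. by rewrite {1}[x]intEsign rmorphMsign mulf_eq0 signr_eq0. Qed.

Lemma good_specializations_int (K : fieldType) :
  [pchar K] =i pred0 -> good_specializations (intr : {rmorphism int -> K}).
Proof.
move=> K0 s s0; have sN0 : s != 0 by apply: contraNneq s0 => ->.
have [p p_gt p_pr] := prime_above `|s|%N.
have [L [phi _]] := countable_algebraic_closure 'F_p.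
have Lp : p \in [pchar L] by rewrite (fmorph_pchar phi) pchar_Fp.
exists p, L, (intr : {rmorphism int -> L}); split=> //=.
  by rewrite intr_eq0_absz -(dvdn_pcharf Lp) gtnNdvd // absz_gt0.
move=> x /eqP; rewrite intr_eq0_absz; move/pcharf0P: K0 => ->.
by rewrite absz_eq0 => /eqP ->.
Qed.

Section PolynomialExtension.
Variables (K : fieldType) (A : comNzRingType) (alpha : {rmorphism A -> K}).

(** Multiplying a polynomial of degree m by the m-th power of [c] turns it
    into a polynomial in c times the variable; for the leading coefficient [c]
    of a polynomial vanishing at b, this is what makes c b integral. *)
Lemma horner_map_lead (S : comNzRingType) (phi : {rmorphism A -> S})
    (f : {poly A}) m c b : (size f <= m.+1)%N ->
  phi c ^+ m * (map_poly phi f).[b]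
    = (map_poly phi (\poly_(i < m.+1) (f`_i * c ^+ (m - i)))).[phi c * b].
Proof.
move=> szf.
rewrite (@horner_coef_wide _ m.+1) ?(leq_trans (size_poly _ _)) //.
rewrite [RHS](@horner_coef_wide _ m.+1); last first.
  exact: leq_trans (size_poly _ _) (size_poly _ _).
rewrite mulr_sumr; apply: eq_bigr => i _.
rewrite !coef_map_id0 ?rmorph0 // coef_poly ltn_ord rmorphM rmorphXn exprMn.
rewrite -[X in phi c ^+ X * _](subnK (ltn_ord i : i <= m)%N) exprD.
by rewrite mulrACA [phi f`_i * _]mulrC.
Qed.

Lemma root_times_lead_integral (P : {poly A}) b :
  alpha (lead_coef P) != 0 -> root (map_poly alpha P) b ->
  integralOver alpha (alpha (lead_coef P) * b).
Proof.
set c := lead_coef P => c0 /eqP Pb.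
have P0 : P != 0 by apply: contraNneq c0; rewrite /c => ->;
  rewrite lead_coef0 rmorph0.
have szP : size P = (size P).-1.+1 by rewrite prednK // size_poly_gt0.
have := @horner_map_lead _ alpha P (size P).-1 c b.
rewrite -szP leqnn Pb mulr0 => /(_ isT).
set n := (size P).-1 in szP *.
case: n szP => [|n] szP.
  rewrite (size1_polyC (eq_leq szP)) map_polyC hornerC in Pb.
  by case/eqP: c0; rewrite /c lead_coefE szP.
have -> : \poly_(i < size P) (P`_i * c ^+ (n.+1 - i)) =
    c *: ('X^(n.+1) + \poly_(i < n.+1) (P`_i * c ^+ (n - i))).
  apply/polyP => i; rewrite coefZ coefD coefXn !coef_poly szP ltnS leq_eqVlt.
  case: eqVneq => [->|] /=.
    by rewrite ltnn subnn expr0 addr0 /c lead_coefE szP.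
  rewrite ltnS add0r; case: ifP => [lein|]; last by rewrite mulr0.
  by move=> _; rewrite subSn // exprS mulrCA.
rewrite map_polyZ hornerZ => /esym/eqP; rewrite mulf_eq0 (negPf c0) /= => rt.
exists ('X^(n.+1) + \poly_(i < n.+1) (P`_i * c ^+ (n - i))) => //.
by rewrite monicE lead_coefDl ?lead_coefXn // size_polyXn ltnS size_poly.
Qed.

(** Factors of the variable can be divided out of an annihilator of [b]
    because [b] is nonzero. *)
Lemma annihilator_with_constant_term (Q : {poly A}) b :
  b != 0 -> map_poly alpha Q != 0 -> root (map_poly alpha Q) b ->
  exists2 Q' : {poly A}, alpha Q'`_0 != 0 & root (map_poly alpha Q') b.
Proof.
move=> b0; elim/poly_ind: Q => [|Q c IHQ]; first by rewrite map_poly0 eqxx.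
have [c0|c0 _ Qb] := eqVneq (alpha c) 0; last first.
  by exists (Q * 'X + c%:P) => //; rewrite coefD coefMX coefC add0r.
rewrite rmorphD rmorphM /= map_polyX map_polyC /= c0 addr0 => QX0.
rewrite rootM rootX (negPf b0) orbF; apply: IHQ.
by apply: contraNneq QX0 => ->; rewrite mul0r.
Qed.

(** If b is transcendental, any point at which a nonzero polynomial does not
    vanish will do for the image of b. Otherwise let P be an annihilator of b
    of least degree, with leading coefficient c. A specialization of [A] under
    which c survives extends to b by choosing a root of P: the
    pseudo-remainder modulo P of a polynomial vanishing at b vanishes, by
    minimality. To keep f(b) nonzero it suffices to keep nonzero the constant
    term of an annihilator of c ^+ m * f(b), which exists because c b is
    integral: if f(b) were sent to 0 then so would that term. *)
Lemma good_specializations_horner (b : K) :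
  good_specializations alpha ->
  good_specializations (eval_at alpha b).
Proof.
move=> goodA f; rewrite eval_atE => fb0.
have [|transc] := pselect (exists P : {poly A},
   (map_poly alpha P != 0) && root (map_poly alpha P) b); last first.
  have fN0 : map_poly alpha f != 0.
    by apply: contraNneq fb0 => ->; rewrite horner0.
  have [p [L [phi [Lp phic kerphi]]]] := goodA f`_(size (map_poly alpha f)).-1
    ltac:(by rewrite -coef_map -lead_coefE lead_coef_eq0).
  have : map_poly phi f != 0.
    apply: contraNneq phic => f0; rewrite -coef_map f0 coef0 //.
  move=> /closed_nonrootP[w fw].
  exists p, L, (eval_at phi w); split=> //.
  move=> g gb; have [g0|gN0] := eqVneq (map_poly alpha g) 0; last first.
    by case: transc; exists g; rewrite gN0; apply/eqP.
  rewrite eval_atE (_ : map_poly phi g = 0) ?horner0 //.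
  apply/polyP => i; rewrite coef_map coef0; apply: kerphi.
  by rewrite -coef_map g0 coef0.
move=> algb.
(* The degree is minimized over [A] and not over the image of [A], so that the
   leading coefficient of P survives under [alpha]. *)
have ex_sz : exists n, `[< exists P : {poly A},
   [&& size P == n, map_poly alpha P != 0 & root (map_poly alpha P) b] >].
  by case: algb => P Pb; exists (size P); apply/asboolP; exists P; rewrite eqxx.
case: (ex_minnP ex_sz) => n /asboolP[P /and3P[/eqP szP P0 Pb]] minP.
have {}minP (g : {poly A}) : (size g < size P)%N ->
    root (map_poly alpha g) b -> map_poly alpha g = 0.
  move=> szg gb; apply: contraTeq szg => g0; rewrite -leqNgt szP minP //.
  by apply/asboolP; exists g; rewrite eqxx g0.
have PN0 : P != 0 by apply: contraTneq P0 => ->; rewrite map_poly0 eqxx.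
have c0 : alpha (lead_coef P) != 0.
  apply: contraNneq P0 => c0.
  pose P' := P - lead_coef P *: 'X^((size P).-1).
  have PP' : map_poly alpha P' = map_poly alpha P.
    by rewrite rmorphB /= map_polyZ /= c0 scale0r subr0.
  rewrite -PP' minP ?PP' // (leq_ltn_trans _ (_ : (size P).-1 < size P)%N) //.
    apply/leq_sizeP => j; rewrite coefB coefZ coefXn.
    case: eqVneq => [->|ne lej]; first by rewrite mulr1 subrr.
    rewrite mulr0 subr0 nth_default // -(prednK (n := size P)) ?size_poly_gt0
      //.
    by rewrite ltn_neqAle eq_sym ne.
  by rewrite prednK ?size_poly_gt0.
set c := lead_coef P in c0.
pose m := (size f).-1.
have szf : (size f <= m.+1)%N by rewrite leqSpred.
have intf : integralOver alpha (alpha c ^+ m * (map_poly alpha f).[b]).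
  rewrite (horner_map_lead _ _ _ szf); apply: integral_horner.
    by apply/integral_poly => i; rewrite coef_map; apply: integral_id.
  exact: root_times_lead_integral.
have [Q0 Q0mon Q0f] := intf.
case: (@annihilator_with_constant_term _ _ _ _ Q0f).
- by rewrite mulf_neq0 ?expf_neq0.
- by rewrite monic_neq0 // monic_map.
move=> Q Qc Qf.
have [|p [L [phi [Lp]]]] := goodA (c * Q`_0);
  first by rewrite rmorphM mulf_neq0.
rewrite rmorphM mulf_eq0 negb_or => /andP[phic phiQ] kerphi.
have kerphiP (g : {poly A}) : map_poly alpha g = 0 -> map_poly phi g = 0.
  move=> g0; apply/polyP => i; rewrite coef_map coef0; apply: kerphi.
  by rewrite -coef_map g0 coef0.
have : size (map_poly phi P) != 1%N.
  rewrite size_map_poly_id0 //.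
  apply: contraTneq Pb => szP1.
  rewrite (size1_polyC (eq_leq szP1)) map_polyC rootC.
  by rewrite /c lead_coefE szP1 in c0.
move=> /closed_rootP[w Pw].
have kerw (g : {poly A}) : (map_poly alpha g).[b] = 0 -> (map_poly phi g).[w] =
  0.
  move=> gb; have := Pdiv.ComRing.rdivp_eq P g.
  set q := Pdiv.Ring.rdivp _ _; set r := Pdiv.Ring.rmodp _ _ => divE.
  have r0 : map_poly alpha r = 0.
    apply: minP; first by rewrite Pdiv.Ring.ltn_rmodp -lead_coef_eq0 -/c;
      apply: contraNneq c0 => ->; rewrite rmorph0.
    have /eqP := congr1 (fun h => (map_poly alpha h).[b]) divE.
    rewrite map_polyZ hornerZ gb mulr0 rmorphD rmorphM hornerD hornerM.
    by rewrite (eqP Pb) mulr0 add0r eq_sym.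
  have /eqP := congr1 (fun h => (map_poly phi h).[w]) divE.
  rewrite map_polyZ hornerZ rmorphD rmorphM hornerD hornerM (eqP Pw) mulr0.
  rewrite /= (kerphiP _ r0) horner0 addr0 rmorphXn mulf_eq0 expf_eq0.
  by rewrite (negPf phic) andbF /= => /eqP.
exists p, L, (eval_at phi w); split=> //.
apply: contraNneq phiQ; rewrite eval_atE => fw.
have := kerw (Q \Po (c ^+ m *: f)).
rewrite !map_comp_poly !horner_comp !map_polyZ !hornerZ !rmorphXn /=.
rewrite fw mulr0 horner_coef0 coef_map => -> //.
exact/eqP.
Qed.

End PolynomialExtension.

Lemma generators_good_specializations (K : fieldType) (s : seq K) :
    [pchar K] =i pred0 ->
  exists (B : comNzRingType) (beta : {rmorphism B -> K}),
    good_specializations beta /\ forall x, x \in s -> exists y, beta y = x.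
Proof.
move=> K0; elim: s => [|b s [B [beta [goodB imB]]]].
  by exists int, intr; split=> //; apply: good_specializations_int.
exists {poly B}, (eval_at beta b).
split=> [|x]; first exact: good_specializations_horner.
rewrite inE => /predU1P[->|/imB[y <-]].
  by exists 'X; rewrite eval_atE map_polyX hornerX.
by exists y%:P; rewrite eval_atE map_polyC hornerC.
Qed.

(** * Class sums of p-th powers in characteristic p *)

(** The orbits of [s] have 1 or p elements, and those with p elements
    contribute p times a constant. *)
Lemma sum_perm_prime_order (p : nat) (K : nzRingType) (T : finType)
    (s : {perm T}) (F : T -> K) :
  p \in [pchar K] -> (s ^+ p)%g = 1%g -> (forall x, F (s x) = F x) ->
  \sum_x F x = \sum_(x | s x == x) F x.
Proof.
move=> Kp sp1 Fs; have p_pr := pcharf_prime Kp.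
have sporb x : porbit s x \in porbits s by apply/imsetP; exists x.
rewrite (partition_big (porbit s) (mem (porbits s))) //=.
rewrite [RHS](partition_big (porbit s) (mem (porbits s))) //=.
apply: eq_bigr => _ /imsetP[x _ ->].
have Forb y : y \in porbit s x -> F y = F x.
  case/porbitP=> i ->; elim: i => [|i IHi]; first by rewrite expg0 perm1.
  by rewrite expgSr permM Fs.
have : (#|porbit s x| %| p)%N.
  by rewrite porbitE (dvdn_trans (dvdn_orbit _ _ _)) // order_dvdn sp1.
have /primeP[_ p_div] := p_pr; move=> /p_div /pred2P[orb1|orbp].
  apply: eq_bigl => y; rewrite eq_porbit_mem andb_idl // => yx.
  have /card1P[z orbz] : #|porbit s y| == 1%N.
    by rewrite (eqP (_ : porbit s y == porbit s x)) ?orb1 // eq_porbit_mem.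
  have := mem_porbit s 1 y; rewrite expg1 orbz inE => /eqP ->.
  by have := porbit_id s y; rewrite orbz inE eq_sym.
rewrite [RHS]big1 => [|y /andP[/eqP sy]]; last first.
  rewrite eq_porbit_mem porbit_sym => /porbitP[i xi].
  have x1 : porbit s x = [set x].
    have sx : s x = x.
      by rewrite xi -permM -expgSr expgS permM sy.
    apply/setP => z; rewrite inE; apply/porbitP/eqP => [[j ->]|->].
      by elim: j => [|j IHj]; rewrite ?expg0 ?perm1 // expgSr permM IHj.
    by exists 0%N; rewrite expg0 perm1.
  by move: p_pr; rewrite -orbp x1 cards1.
rewrite (eq_bigl (mem (porbit s x))) => [|y]; last by rewrite eq_porbit_mem.
by rewrite (eq_bigr (fun=> F x)) // sumr_const orbp -mulr_natr pcharf0 // mulr0.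
Qed.

Section TraceOfPrimePower.
Variables (p : nat) (K : nzRingType) (R : nzRingType) (tau : {additive R -> K}).
Hypothesis Kp : p \in [pchar K].
Hypothesis tauC : forall a b, tau (a * b) = tau (b * a).

(** The p-th power expands into a sum over maps from 'I_p to [I]; rotating
    such a map does not change the trace of the corresponding product, and the
    maps invariant under rotation are the constant ones. *)
Lemma trace_exp_sum (I : finType) (a : I -> R) :
  tau ((\sum_i a i) ^+ p) = \sum_i tau (a i ^+ p).
Proof.
have p_pr := pcharf_prime Kp.
case: p p_pr Kp => // q p_pr Kq.
rewrite -[X in _ ^+ X]card_ord -prodr_const bigA_distr_bigA /= raddf_sum /=.
pose rot (f : {ffun 'I_q.+1 -> I}) := [ffun j => f (ordS j)].
have rotI : injective rot.
  move=> f g fg; apply/ffunP => j;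
    have := congr1 (fun h : {ffun _ -> _} => h (ord_pred j)) fg.
  by rewrite !ffunE ord_predK.
have iter_rot k f : (perm rotI ^+ k)%g f = [ffun j => f (iter k (@ordS q.+1)
  j)].
  elim: k => [|k IHk]; first by apply/ffunP => j; rewrite expg0 perm1 ffunE.
  by rewrite expgSr permM IHk permE; apply/ffunP => j; rewrite !ffunE iterSr.
have iter_ordS k (j : 'I_q.+1) : iter k (@ordS q.+1) j = ((j + k) %% q.+1)%N :>
  nat.
  elim: k => [|k IHk]; first by rewrite addn0 modn_small.
  by rewrite iterS /= IHk -addn1 modnDml addn1 addnS.
rewrite (sum_perm_prime_order (s := perm rotI) Kq).
- rewrite (reindex_onto (fun i => [ffun=> i]) (fun f : {ffun _ -> _} => f
  ord0)).
    rewrite (eq_bigl predT) => [|i /=].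
      by apply: eq_bigr => i _; under eq_bigr do rewrite ffunE;
        rewrite prodr_const card_ord.
    rewrite ffunE eqxx andbT permE; apply/eqP/ffunP => j; by rewrite !ffunE.
  move=> f /eqP sf; apply/ffunP => j; rewrite ffunE.
  have : (perm rotI ^+ j)%g f = f.
    elim: (nat_of_ord j) => [|k IHk]; first by rewrite expg0 perm1.
    by rewrite expgSr permM IHk.
  rewrite iter_rot => /(congr1 (fun h : {ffun _ -> _} => h ord0));
    rewrite ffunE => <-.
  by congr (f _); apply: ord_inj; rewrite iter_ordS add0n modn_small.
- apply/permP => f; rewrite iter_rot perm1; apply/ffunP => j; rewrite ffunE.
  by congr (f _); apply: ord_inj; rewrite iter_ordS modnDr modn_small.
move=> f; rewrite permE big_ord_recr big_ord_recl /= tauC.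
congr (tau (_ * _)); first by rewrite ffunE; congr (a (f _)); apply: val_inj;
  rewrite /= modnn.
apply: eq_bigr => j _; rewrite ffunE; congr (a (f _)); apply: val_inj.
by rewrite /= modn_small // ltnS.
Qed.

End TraceOfPrimePower.

Section ClassSums.
Variables (K : comNzRingType) (G : groupType).
Local Notation KG := (group_algebra K G).
Local Notation coef := (@ga_coef K G).
Local Notation supp := (@ga_supp K G).
Implicit Types (f g : KG) (C : pred G).

Definition ga_delta (x : G) : KG := ga_of [fset x]%fset (fun y => (y == x)%:R).

Lemma ga_deltaE x y : coef (ga_delta x) y = (y == x)%:R.
Proof. by apply: ga_ofE; rewrite in_fset1 => /negPf ->. Qed.

(** A trace on the group algebra as soon as [C] is invariant under
    conjugation. *)
Definition class_sum C f : K := \sum_(x <- supp f | C x) coef f x.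

Lemma class_sum_widen (S : {fset G}) C f : {subset supp f <= S} ->
  class_sum C f = \sum_(x <- S | C x) coef f x.
Proof.
move=> /fsubsetP fS; rewrite /class_sum big_mkcond [RHS]big_mkcond.
apply: (big_fset_incl _ fS) => x _ xf.
by rewrite (ga_notin xf) if_same.
Qed.

Lemma class_sum_is_additive C : zmod_morphism (class_sum C).
Proof.
move=> f g; pose S := (supp f `|` supp g)%fset.
have sub h : (forall x, coef f x = 0 -> coef g x = 0 -> coef h x = 0) ->
    {subset supp h <= S}.
  move=> h0 x; apply: contraLR; rewrite in_fsetU negb_or => /andP[xf xg].
  by rewrite mem_finsupp negbK; apply/eqP/h0; apply: ga_notin.
rewrite !(@class_sum_widen S); try (by apply: sub); last first.
  by apply: sub => x fx gx; rewrite ga_addE ga_oppE fx gx subrr.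
by rewrite -sumrB; apply: eq_bigr => x _; rewrite ga_addE ga_oppE.
Qed.

HB.instance Definition _ C :=
  GRing.isZmodMorphism.Build KG K (class_sum C) (class_sum_is_additive C).

Lemma class_sum_scale_delta C a x :
  class_sum C (a *: ga_delta x) = if C x then a else 0.
Proof.
rewrite (@class_sum_widen [fset x]%fset).
  rewrite big_mkcond big_seq_fset1; case: ifP => // _.
  by rewrite ga_scaleE ga_deltaE eqxx mulr1.
move=> y; apply: contraLR; rewrite in_fset1 mem_finsupp negbK => /negPf yx.
by rewrite [X in X == _]ga_scaleE ga_deltaE yx mulr0.
Qed.

Lemma ga_sum_delta f : f = \sum_(x <- supp f) coef f x *: ga_delta x.
Proof.
have coefD x : {morph coef^~ x : g h / g + h >-> g + h} by move=> g h;
  rewrite ga_addE.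
apply: ga_P => x.
rewrite (big_morph (coef^~ x) (coefD x) (ga_zeroE _ x)).
have [xf|xf] := boolP (x \in supp f); last first.
  rewrite (ga_notin xf) big_seq big1 // => y yf.
  by rewrite ga_scaleE ga_deltaE; case: eqVneq xf yf => [->/negPf->//|];
    rewrite mulr0.
rewrite (big_fsetD1 x) //= ga_scaleE ga_deltaE eqxx mulr1 big1_fset ?addr0 //.
by move=> y; rewrite !inE => /andP[yx _] _;
  rewrite ga_scaleE ga_deltaE eq_sym (negPf yx) mulr0.
Qed.

Lemma ga_deltaM x y : ga_delta x * ga_delta y = ga_delta (x * y)%g.
Proof.
apply: ga_P => z; rewrite (@ga_mul_widen _ _ [fset x]%fset).
  rewrite big_seq_fset1 !ga_deltaE eqxx mul1r.
  by rewrite -(inj_eq (@mulgI _ x)) mulVKg.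
move=> w; apply: contraLR; rewrite in_fset1 mem_finsupp negbK => /negPf wx.
by rewrite [X in X == _]ga_deltaE wx.
Qed.

Lemma ga_delta_exp x n : ga_delta x ^+ n = ga_delta (x ^+ n)%g.
Proof.
elim: n => [|n IHn]; last by rewrite exprS IHn ga_deltaM expgS.
by apply: ga_P => y; rewrite expr0 expg0 ga_deltaE -(ga_oneE K y).
Qed.

Lemma class_sumC C f g : (forall x y, C (x * y)%g = C (y * x)%g) ->
  class_sum C (f * g) = class_sum C (g * f).
Proof.
move=> Cxy; rewrite [f]ga_sum_delta [g]ga_sum_delta !mulr_suml !raddf_sum.
under eq_bigr => x _ do rewrite mulr_sumr raddf_sum.
under [RHS]eq_bigr => x _ do rewrite mulr_sumr raddf_sum.
rewrite exchange_big /=; apply: eq_bigr => y _; apply: eq_bigr => x _.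
rewrite -!scalerAl -!scalerAr !scalerA !ga_deltaM !class_sum_scale_delta Cxy.
by rewrite mulrC.
Qed.

Lemma class_sum_exp_char p C f : p \in [pchar K] ->
  (forall x y, C (x * y)%g = C (y * x)%g) ->
  class_sum C (f ^+ p) = class_sum (fun x => C (x ^+ p)%g) f ^+ p.
Proof.
move=> Kp Cxy; rewrite {1}[f]ga_sum_delta big_seq_fsetE /=.
rewrite (trace_exp_sum (tau := class_sum C)) //; last by move=> *;
  apply: class_sumC.
rewrite /class_sum big_seq_fsetE /= -(pFrobenius_autE Kp) rmorph_sum /=
  [RHS]big_mkcond.
apply: eq_bigr => x _.
by rewrite exprZn ga_delta_exp class_sum_scale_delta pFrobenius_autE.
Qed.

End ClassSums.

(** * Idempotents have trace 0 or 1 *)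

Lemma iter_repeats (T : eqType) (f : T -> T) (x : T) (s : seq T) :
  (forall k, iter k f x \in s) ->
  exists a b, (a < b)%N /\ iter a f x = iter b f x.
Proof.
move=> xs; pose t := [seq iter k f x | k <- iota 0 (size s).+1].
have : ~~ uniq t.
  have ts : {subset t <= s} by move=> _ /mapP[k _ ->].
  by apply/negP => /uniq_leq_size/(_ ts); rewrite size_map size_iota ltnn.
case/(uniqPn x) => a [b [ab]]; rewrite size_map size_iota => lb.
rewrite !(nth_map 0%N) ?size_iota ?(ltn_trans ab) //.
by rewrite !nth_iota ?(ltn_trans ab) // !add0n => abE; exists a, b.
Qed.

Lemma big_classes0 (T : eqType) (V : nmodType) (r : rel T)
    (F : T -> V) (s : seq T) :
    equivalence_rel r ->
    (forall x, x \in s -> \sum_(y <- s | r x y) F y = 0) ->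
  \sum_(y <- s) F y = 0.
Proof.
move=> r_eq; have [n] := ubnP (size s); elim: n s => // n IHn [|x s] sz F0.
  by rewrite big_nil.
have rxx z : r z z by case: (r_eq z z z).
have rC y z w : r y z -> r y w = r z w by case: (r_eq y z w) => _ /[apply].
rewrite (bigID (r x)) /= F0 ?mem_head // add0r -big_filter.
apply: IHn => [|y].
  by rewrite /= rxx /= size_filter (leq_ltn_trans (count_size _ _)).
rewrite mem_filter => /andP[xy ys]; rewrite big_filter_cond -[RHS](F0 y ys).
apply: eq_bigl => z; apply/andb_idl => yz; apply: contraNN xy => xz.
by rewrite (rC _ _ _ xz) -(rC _ _ _ yz) rxx.
Qed.

Section ConjugacyClassSums.
Variable G : groupType.

Definition conjugate (x y : G) : bool := `[< exists h, y = (x ^ h)%g >].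

Lemma conjugateP x y : reflect (exists h, y = (x ^ h)%g) (conjugate x y).
Proof. exact: asboolP. Qed.

Lemma conjugate_refl x : conjugate x x.
Proof. by apply/conjugateP; exists 1%g; rewrite conjg1. Qed.

Lemma conjugate_equiv : equivalence_rel conjugate.
Proof.
move=> x y z; split; first exact: conjugate_refl.
move=> /conjugateP[h ->]; apply/conjugateP/conjugateP => -[k ->].
  by exists (h^-1 * k)%g; rewrite -conjgM mulVKg.
by exists (h * k)%g; rewrite conjgM.
Qed.

Lemma conjugate_trans x y z : conjugate x y -> conjugate y z -> conjugate x z.
Proof. by move=> xy; case: (conjugate_equiv x y z) => _ ->. Qed.

Lemma conjugate_sym x y : conjugate x y = conjugate y x.
Proof.
apply/idP/idP => xy; first by case: (conjugate_equiv x y x) => _ <- //;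
  apply: conjugate_refl.
by case: (conjugate_equiv y x y) => _ <- //; apply: conjugate_refl.
Qed.

Lemma conjugateX x y n : conjugate x y -> conjugate (x ^+ n)%g (y ^+ n)%g.
Proof. by move=> /conjugateP[h ->]; apply/conjugateP; exists h;
  rewrite conjXg. Qed.

Lemma conjugate_mulC g x y : conjugate g (x * y)%g = conjugate g (y * x)%g.
Proof.
rewrite ![conjugate g _]conjugate_sym;
  case: (conjugate_equiv (x * y)%g (y * x)%g g) => _ -> //.
by apply/conjugateP; exists x; rewrite conjgE mulgA mulKg.
Qed.

Lemma class_sum_eq0 (K : comNzRingType) (f : group_algebra K G) (C : pred G) :
    (forall x y, C x -> conjugate x y -> C y) ->
    (forall x, x \in ga_supp f -> C x -> class_sum (conjugate x) f = 0) ->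
  class_sum C f = 0.
Proof.
move=> Cconj f0; rewrite /class_sum -big_filter.
apply: (big_classes0 conjugate_equiv) => x; rewrite mem_filter => /andP[Cx xf].
rewrite big_filter_cond -[RHS](f0 x xf Cx); apply: eq_bigl => y.
by apply/andb_idl/Cconj.
Qed.

Definition power_conjugate_trivial : Prop :=
  forall (x h : G) q, (1 < q)%N -> (x ^ h)%g = (x ^+ q)%g -> x = 1%g.

Section Chain.
Hypothesis no_power_conj : power_conjugate_trivial.

(** As f = f ^+ p, a class with nonzero sum is the p-th power of a class with
    nonzero sum that meets the support of f. The resulting chain of classes
    returns to some class y, which is then conjugate to a power y ^+ (p ^ d),
    d > 0; so y = 1, and g is conjugate to a power of y. *)
Lemma idempotent_class_sum_char p (L : comNzRingType)
    (f : group_algebra L G) g :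
  p \in [pchar L] -> f * f = f -> class_sum (conjugate g) f != 0 -> g = 1%g.
Proof.
move=> Lp ff g0; have p_pr := pcharf_prime Lp.
have fp : f ^+ p = f.
  case: p p_pr {Lp} => // n _; elim: n => [|n IHn]; first exact: expr1.
  by rewrite exprS IHn.
have root x : exists y, class_sum (conjugate x) f != 0 ->
    [&& y \in ga_supp f, class_sum (conjugate y) f != 0 & conjugate x (y ^+
      p)%g].
  have [x0|x0] := boolP (class_sum (conjugate x) f == 0); first by exists 1%g.
  suff [y Py] : exists y,
    [&& y \in ga_supp f, class_sum (conjugate y) f != 0 & conjugate x (y ^+
      p)%g] by exists y.
  apply: contrapT => noy; case/negP: x0; rewrite -fp class_sum_exp_char //;
    last exact: conjugate_mulC.
  rewrite class_sum_eq0 ?expr0n ?(gtn_eqF (prime_gt0 p_pr)) // => y z.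
    by move=> xy yz; apply: conjugate_trans xy (conjugateX p yz).
  move=> xy; apply/eqP/negPn/negP => y0; apply: noy; exists y; by apply/and3P.
have {root}[root rootP] := choice root.
pose a i := iter i root g.
have a0 i : class_sum (conjugate (a i)) f != 0.
  by elim: i => // i /rootP/and3P[].
have aS i : (a i.+1 \in ga_supp f) /\ conjugate (a i) (a i.+1 ^+ p)%g.
  by have /and3P[] := rootP _ (a0 i).
have aX d i : conjugate (a i) (a (d + i)%N ^+ (p ^ d))%g.
  elim: d => [|d IHd]; first by rewrite expg1 conjugate_refl.
  apply: conjugate_trans IHd _; rewrite expnS expgM; apply: conjugateX.
  by case: (aS (d + i)%N).
have [i [d [d0 aid]]] : exists i d, (0 < d)%N /\ a (d + i)%N = a i.
  have inS k : iter k root (root g) \in ga_supp f.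
    by rewrite -iterSr; case: (aS k).
  have [i [j [ij]]] := iter_repeats inS; rewrite -!iterSr => aij.
  by exists i.+1, (j - i)%N; rewrite subn_gt0 ij addnS subnK // ltnW.
have /conjugateP[h] := aX d i; rewrite aid => /esym/no_power_conj ai1.
have /conjugateP[k] := aX i 0%N.
rewrite addn0 ai1 ?expg1n; last by rewrite -(exp1n d) ltn_exp2r ?prime_gt1.
by move=> /esym/eqP; rewrite conjg_eq1 => /eqP.
Qed.

(** The coefficients of [f] generate a ring on which a specialization to
    positive characteristic is defined; it carries [f] to an idempotent and
    can be chosen so that the given class sum remains nonzero. *)
Lemma idempotent_class_sum (K : fieldType) (f : group_algebra K G) g :
  [pchar K] =i pred0 -> f * f = f -> class_sum (conjugate g) f != 0 -> g = 1%g.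
Proof.
move=> K0 ff g0; pose S := ga_supp f.
have [B [beta [goodB imB]]] :=
  generators_good_specializations [seq ga_coef f x | x <- S] K0.
have lift x : exists y, beta y = ga_coef f x /\ (x \notin S -> y = 0).
  have [xS|xS] := boolP (x \in S); last by exists 0; rewrite rmorph0 ga_notin.
  by have [y <-] := imB _ (map_f (ga_coef f) xS); exists y.
have {lift}[F /all_and2[betaF F0]] := choice lift.
have betag : beta (\sum_(x <- S | conjugate g x) F x) = class_sum (conjugate g)
  f.
  by rewrite rmorph_sum; apply: eq_bigr.
have [|p [L [phi [Lp phig kerphi]]]] := goodB (\sum_(x <- S | conjugate g x) F
  x).
  by rewrite betag.
pose f' : group_algebra L G := ga_of S (phi \o F).
have f'E x : ga_coef f' x = phi (F x).
  by apply: ga_ofE => /= /F0 ->; rewrite rmorph0.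
have sub : {subset ga_supp f' <= S}.
  move=> x; apply: contraLR => xS; rewrite mem_finsupp negbK.
  by rewrite [X in X == _]f'E F0 // rmorph0.
apply: (@idempotent_class_sum_char p L f') => //; last first.
  rewrite (class_sum_widen _ sub); under eq_bigr do rewrite f'E.
  by rewrite -rmorph_sum.
apply: ga_P => x; rewrite (ga_mul_widen _ _ sub) f'E; apply/eqP.
under eq_bigr do rewrite !f'E -rmorphM.
rewrite -rmorph_sum -subr_eq0 -rmorphB; apply/eqP/kerphi.
rewrite rmorphB rmorph_sum betaF -[in X in _ - X]ff; apply/eqP;
  rewrite subr_eq0; apply/eqP.
rewrite ga_mulE; apply: eq_bigr => y _; by rewrite rmorphM !betaF.
Qed.

End Chain.
End ConjugacyClassSums.

Lemma augmentationM (K : comNzRingType) (G : groupType)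
    (f g : group_algebra K G) :
  class_sum predT (f * g) = class_sum predT f * class_sum predT g.
Proof.
rewrite {1}[f]ga_sum_delta {1}[g]ga_sum_delta mulr_suml raddf_sum.
rewrite [class_sum _ f]/class_sum mulr_suml; apply: eq_bigr => x _.
rewrite mulr_sumr raddf_sum [class_sum _ g]/class_sum mulr_sumr;
  apply: eq_bigr => y _.
by rewrite /= -scalerAl -scalerAr scalerA ga_deltaM class_sum_scale_delta.
Qed.

(** All class sums but the one of 1 vanish, so the coefficient of 1 is the
    augmentation, and the augmentation of an idempotent is an idempotent. *)
Lemma idempotent_coef1 (G : groupType) (K : fieldType) (e : group_algebra K G) :
    power_conjugate_trivial G ->
    [pchar K] =i pred0 -> e * e = e ->
  ga_coef e 1%g = 0 \/ ga_coef e 1%g = 1.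
Proof.
move=> noconj K0 ee.
have aug1 : class_sum predT e = ga_coef e 1%g.
  rewrite /class_sum (bigID (pred1 1%g)) /= [X in _ + X](_ : _ = 0) ?addr0;
    last first.
    apply: (@class_sum_eq0 _ _ e (fun x => x != 1%g)) => [x y x1|x _ x1].
      by move=> /conjugateP[h ->]; rewrite conjg_eq1.
    by apply: contraNeq x1 => /(idempotent_class_sum noconj K0 ee) ->.
  rewrite big_mkcond; have [e1|e1] := boolP (1%g \in ga_supp e).
    rewrite (big_fsetD1 1%g) //= eqxx big1_fset ?addr0 // => x.
    by rewrite !inE => /andP[/negPf ->].
  rewrite (ga_notin e1) big_seq big1 // => x xe; case: eqP => // x1.
  by rewrite -x1 xe in e1.
have : class_sum predT e * (class_sum predT e - 1) = 0.
  by rewrite mulrBr mulr1 -augmentationM ee subrr.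
rewrite aug1 => /eqP; rewrite mulf_eq0 subr_eq0 => /orP[]/eqP; by [left|right].
Qed.

(** * Idempotents of trace 0 vanish *)

(** [tr] plays the part of the real part of the trace, so that [ip] is a real
    inner product for which left multiplication by [star a] is adjoint to left
    multiplication by [a]. *)
Section TracePositivity.
Variables (R : archiRealFieldType) (A : nzRingType).
Variables (star : {additive A -> A}) (tr : {additive A -> R}).
Hypothesis starM : forall a b, star (a * b) = star b * star a.
Hypothesis starK : involutive star.
Hypothesis trC : forall a b, tr (a * b) = tr (b * a).
Hypothesis tr_star : forall a, tr (star a) = tr a.

Local Notation ip x y := (tr (star x * y)).
Local Notation N x := (ip x x).

Hypothesis N_ge0 : forall x, 0 <= N x.
Hypothesis N_eq0 : forall x, N x = 0 -> x = 0.
Hypothesis tr_sqr_le : forall x, tr x ^+ 2 <= N x.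

Definition bounded_left_mul a := exists B : R, forall x, N (a * x) <= B * N x.

Lemma bounded_left_mulD a b :
  bounded_left_mul a -> bounded_left_mul b -> bounded_left_mul (a + b).
Proof.
move=> [B1 le1] [B2 le2]; exists (2 * B1 + 2 * B2) => x.
have parallelogram u v : N (u + v) + N (u - v) = 2 * N u + 2 * N v.
  by rewrite !(raddfD, raddfN, mulrDl, mulrDr, mulNr, mulrN) /=; ring.
rewrite mulrDl; have := parallelogram (a * x) (b * x).
by have := N_ge0 (a * x - b * x); have := le1 x; have := le2 x; lra.
Qed.

Hypothesis all_bounded : forall a, bounded_left_mul a.

Lemma ip_sym x y : ip x y = ip y x.
Proof. by rewrite -tr_star starM starK. Qed.

Lemma star_one : star 1 = 1.
Proof. by have := starM (star 1) 1; rewrite mulr1 !starK mulr1. Qed.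

(** With s = star e and z = 1 + star (e - s) * (e - s) one has e z = z e = e s
    e. Choose an integer M such that ip x (z x) and N (z x) are at most M N x,
    and put w = M - z, which is positive. Then e w ^+ k.+1 = M (e w ^+ k) - (e
    s e) w ^+ k, and tr (e s e w ^+ k) = ip e (w ^+ k e) is nonnegative, so tr
    e = 0 forces tr (e w ^+ k.+1) <= - M ^+ k N e. On the other hand the norm
    of w is at most M sqrt (1 - 1 / M), so tr (e w ^+ k) is exponentially
    smaller than M ^+ k; hence N e = 0. *)
Lemma idempotent_trace0 (e : A) : e * e = e -> tr e = 0 -> e = 0.
Proof.
move=> ee tre; pose s := star e; pose d := e - s; pose z := 1 - d * d.
have ss : s * s = s by rewrite /s -starM ee.
have star_d : star d = - d by rewrite /d raddfB /= starK opprB.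
have star_z : star z = z by rewrite /z raddfB /= starM star_d star_one mulrNN.
have dd : d * d = e - e * s - s * e + s.
  by rewrite /d mulrBl !mulrBr ee ss opprB addrA addrAC.
have ez : e * z = e * s * e.
  rewrite /z dd mulrBr mulr1 mulrDr !mulrBr ee !mulrA ee.
  by rewrite [e - _ - _ + _]addrAC subrK opprB addrC subrK.
have ze : z * e = e * s * e.
  rewrite /z dd mulrBl mul1r mulrDl !mulrBl -!mulrA ee !mulrA.
  by rewrite subrK opprB addrC subrK.
have N_d x : ip x (z * x) = N x + N (d * x).
  rewrite /z mulrBl mul1r mulrBr raddfB /=; congr (_ + _).
  by rewrite starM star_d mulrN mulNr raddfN !mulrA.
have [B NB] := all_bounded d; have [B' NB'] := all_bounded z.
(* M is an integer so that M - z makes sense in a ring without scalars. *)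
pose M := Num.bound (`|B| + `|B'| + 1).
have leM : `|B| + `|B'| + 1 < M%:R :> R by apply: archi_boundP;
  rewrite !addr_ge0.
have leB1 : B + 1 <= M%:R by have := ler_norm B; have := normr_ge0 B'; lra.
have leB' : B' <= M%:R by have := ler_norm B'; have := normr_ge0 B; lra.
have M_ge1 : 1 <= M%:R :> R by have := normr_ge0 B'; have := normr_ge0 B; lra.
pose w := M%:R - z.
have star_w : star w = w by rewrite /w raddfB raddfMn /= star_one star_z.
have wx x : w * x = x *+ M - z * x by rewrite /w mulrBl mulr_natl.
have ip_w x y : ip x (w * y) = ip (w * x) y.
  by rewrite starM star_w mulrA.
have ipB x y u : ip x (y - u) = ip x y - ip x u by rewrite mulrBr raddfB.
have ipMn x y n : ip x (y *+ n) = n%:R * ip x y.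
  by rewrite mulrnAr raddfMn mulr_natl.
have N_w x : N (w * x) <= (M%:R * (M%:R - 1)) * N x.
  have -> : N (w * x) = M%:R ^+ 2 * N x - 2 * M%:R * ip x (z * x) + N (z * x).
    rewrite {2}wx ipB ipMn ip_sym wx ipB ipMn [ip (_ - _) _]ip_sym ipB ipMn.
    rewrite [ip (z * x) x]ip_sym; ring.
  have := NB' x; have := ler_wpM2r (N_ge0 x) leB'.
  have := mulr_ge0 (ler0n R M) (N_ge0 (d * x)); rewrite N_d; lra.
have ip_w_ge0 j x : 0 <= ip x (w ^+ j * x).
  elim/ltn_ind: j x => -[_ x|[_ x|j IHj x]].
  - by rewrite expr0 mul1r.
  - rewrite expr1 wx ipB ipMn N_d.
    have := NB x; have := ler_wpM2r (N_ge0 x) leB1; lra.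
  - rewrite exprS exprSr -!mulrA ip_w; apply: IHj; by rewrite ltnS leqnSn.
have N_wk k x : N (w ^+ k * x) <= (M%:R * (M%:R - 1)) ^+ k * N x.
  elim: k => [|k IHk]; first by rewrite !expr0 !mul1r.
  rewrite exprS -mulrA (le_trans (N_w _)) // exprS -[leRHS]mulrA ler_wpM2l //.
  by rewrite mulr_ge0 // subr_ge0.
have ew k : GRing.comm e (w ^+ k).
  apply: commrX; rewrite /w; apply: commrB; first exact: commr_nat.
  by rewrite /GRing.comm ez ze.
have t_step k : tr (e * w ^+ k.+1) = M%:R * tr (e * w ^+ k) - ip e (w ^+ k * e).
  rewrite exprSr {2}/w mulrA mulrBr raddfB /= mulr_natr raddfMn mulr_natl.
  congr (_ - _); rewrite ew -mulrA ez mulrA [LHS]trC !mulrA ew.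
  by rewrite -(mulrA (w ^+ k)) ee [LHS]trC !mulrA.
have t_le k : tr (e * w ^+ k.+1) <= - (M%:R ^+ k * N e).
  elim: k => [|k IHk]; first by rewrite t_step !expr0 mulr1 mul1r tre mulr0
    sub0r mul1r.
  rewrite t_step [M%:R ^+ _]exprS; have := ip_w_ge0 k.+1 e;
    have := ler_wpM2l (ler0n R M) IHk; lra.
have bound k : (M%:R ^+ k * N e) ^+ 2 <= (M%:R * (M%:R - 1)) ^+ k.+1 * N e.
  apply: le_trans (le_trans (tr_sqr_le (w ^+ k.+1 * e)) (N_wk k.+1 e)).
  have := t_le k; rewrite -ew => t_lek.
  have h : 0 <= M%:R ^+ k * N e by rewrite mulr_ge0 ?exprn_ge0.
  by rewrite -[leRHS]sqrrN ler_sqr ?nnegrE; lra.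
apply: N_eq0; apply/eqP; rewrite eq_le N_ge0 andbT leNgt; apply/negP => Ne_gt0.
have m_ge0 : 0 <= M%:R - 1 :> R by rewrite subr_ge0.
(* Bernoulli's inequality for (M / (M - 1)) ^+ k, without denominators. *)
have decay k :
    (M%:R - 1) ^+ k * (M%:R - 1 + k%:R) <= (M%:R - 1) * M%:R ^+ k :> R.
  elim: k => [|k IHk]; first by rewrite !expr0 mul1r mulr1 addr0.
  apply: le_trans (_ : (M%:R - 1) ^+ k * (M%:R - 1 + k%:R) * M%:R <= _);
    last first.
    by rewrite exprSr mulrA ler_wpM2r.
  rewrite exprSr -!mulrA ler_wpM2l ?exprn_ge0 // -natr1.
  have := ler0n R k; lra.
have bound' k : M%:R ^+ k * N e <= M%:R * (M%:R - 1) ^+ k.+1.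
  have Mk : 0 < M%:R ^+ k :> R by rewrite exprn_gt0 // (lt_le_trans ltr01).
  rewrite -(ler_pM2r (mulr_gt0 Mk Ne_gt0)) -expr2 (le_trans (bound k)) //.
  by rewrite exprMn [M%:R ^+ k.+1]exprS le_eqVlt; apply/orP; left; apply/eqP;
    ring.
have [k ltk] : exists k : nat, M%:R * (M%:R - 1) ^+ 2 < N e * k%:R.
  exists (Num.bound (M%:R * (M%:R - 1) ^+ 2 / N e)).
  rewrite -ltr_pdivrMl // mulrC archi_boundP //.
  by rewrite divr_ge0 // mulr_ge0 // exprn_ge0.
have Mk : 0 < M%:R ^+ k :> R by rewrite exprn_gt0 // (lt_le_trans ltr01).
have m_k : 0 <= M%:R - 1 + k%:R :> R by rewrite addr_ge0.
have : M%:R ^+ k * (N e * (M%:R - 1 + k%:R)) <= M%:R ^+ k * (M%:R * (M%:R - 1)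
  ^+ 2).
  rewrite mulrA (le_trans (ler_wpM2r m_k (bound' k))) //.
  have := ler_wpM2l (mulr_ge0 (ler0n R M) m_ge0) (decay k).
  rewrite exprS; set a := (M%:R - 1) ^+ k; set b := M%:R ^+ k; lra.
rewrite (ler_pM2l Mk); have := mulr_ge0 (N_ge0 e) m_ge0; lra.
Qed.
End TracePositivity.

Section GroupAlgebraStar.
Variables (R : realType) (G : groupType).
Local Notation CG := (group_algebra R[i] G).
Local Notation coef := (@ga_coef R[i] G).
Local Notation delta := (@ga_delta R[i] G).
Implicit Types (f g : CG) (x y : G) (c : R[i]).

Definition ga_star f : CG :=
  ga_of [fset x^-1%g | x in ga_supp f]%fset (fun x => conjc (coef f x^-1%g)).

Lemma ga_starE f x : coef (ga_star f) x = conjc (coef f x^-1%g).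
Proof.
apply: ga_ofE => xf; rewrite ga_notin ?conjc0 //; apply: contra xf => xf.
by apply/imfsetP; exists x^-1%g => //=; rewrite invgK.
Qed.

Lemma ga_star_is_additive : zmod_morphism ga_star.
Proof.
by move=> f g; apply: ga_P => x;
  rewrite ga_addE ga_oppE !ga_starE ga_addE ga_oppE rmorphB.
Qed.

HB.instance Definition _ := GRing.isZmodMorphism.Build CG CG ga_star
  ga_star_is_additive.

Definition ga_re_trace f : R := complex.Re (coef f 1%g).

Lemma ga_re_trace_is_additive : zmod_morphism ga_re_trace.
Proof.
move=> f g; rewrite /ga_re_trace ga_addE ga_oppE.
by case: (coef f _) => a b; case: (coef g _).
Qed.

HB.instance Definition _ :=
  GRing.isZmodMorphism.Build CG R ga_re_trace ga_re_trace_is_additive.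

Lemma ga_star_scale_delta c x : ga_star (c *: delta x) = conjc c *: delta
  x^-1%g.
Proof.
apply: ga_P => y; rewrite ga_starE !ga_scaleE !ga_deltaE rmorphM.
by rewrite /= conjc_nat -(inj_eq (@invg_inj G)) invgK.
Qed.

Lemma ga_starK : involutive ga_star.
Proof. by move=> f; apply: ga_P => x; rewrite !ga_starE invgK conjcK. Qed.

Lemma ga_starM f g : ga_star (f * g) = ga_star g * ga_star f.
Proof.
rewrite [f]ga_sum_delta [g]ga_sum_delta mulr_suml !raddf_sum /= mulr_sumr.
apply: eq_bigr => x _; rewrite mulr_sumr !raddf_sum /= mulr_suml.
apply: eq_bigr => y _; rewrite !ga_star_scale_delta -!scalerAl -!scalerAr
  !scalerA.
by rewrite !ga_deltaM ga_star_scale_delta invgM rmorphM mulrC.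
Qed.

Lemma ga_re_trace_star f : ga_re_trace (ga_star f) = ga_re_trace f.
Proof. by rewrite /ga_re_trace ga_starE invg1; case: (coef f _). Qed.

Lemma ga_coef1_class_sum f : coef f 1%g = class_sum (pred1 1%g) f.
Proof.
rewrite (@class_sum_widen _ _ (1%g |` ga_supp f)%fset) => [|x xf]; last first.
  by rewrite in_fsetU xf orbT.
rewrite big_mkcond (big_fsetD1 1%g) ?fset1U1 //= eqxx big1_fset ?addr0 // => x.
by rewrite !inE => /andP[/negPf ->].
Qed.

Lemma ga_re_traceC f g : ga_re_trace (f * g) = ga_re_trace (g * f).
Proof.
rewrite /ga_re_trace !ga_coef1_class_sum class_sumC // => x y /=.
by rewrite -[RHS](conjg_eq1 _ x^-1%g) conjgE invgK mulgK.
Qed.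

Local Notation normsq f := (ga_re_trace (ga_star f * f)).

Lemma normsqE f : normsq f =
  \sum_(x <- ga_supp f) (complex.Re (coef f x) ^+ 2 + complex.Im (coef f x) ^+
    2).
Proof.
rewrite ga_re_traceC /ga_re_trace ga_mulE.
rewrite (raddf_sum (@complex.Re R : {additive R[i] -> R})).
apply: eq_bigr => x _; rewrite ga_starE mulg1 invgK.
by case: (coef f x) => a b /=; rewrite mulrN opprK !expr2.
Qed.

Lemma normsq_ge_coef f x :
  complex.Re (coef f x) ^+ 2 + complex.Im (coef f x) ^+ 2 <= normsq f.
Proof.
rewrite normsqE; have [xf|xf] := boolP (x \in ga_supp f); last first.
  rewrite (ga_notin xf) /= expr0n addr0 /= sumr_ge0 // => y _.
  by rewrite addr_ge0 ?sqr_ge0.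
rewrite (big_fsetD1 x) //= lerDl sumr_ge0 // => y _.
by rewrite addr_ge0 ?sqr_ge0.
Qed.

Lemma normsq_ge0 f : 0 <= normsq f.
Proof.
by rewrite (le_trans _ (normsq_ge_coef f 1%g)) // addr_ge0 ?sqr_ge0.
Qed.

Lemma normsq_eq0 f : normsq f = 0 -> f = 0.
Proof.
move=> f0; apply: ga_P => x; have := normsq_ge_coef f x; rewrite f0 ga_zeroE.
case: (coef f x) => a b /= le0.
have /eqP : a ^+ 2 + b ^+ 2 = 0.
  by apply/eqP; rewrite eq_le le0 addr_ge0 ?sqr_ge0.
by rewrite paddr_eq0 ?sqr_ge0 // !sqrf_eq0 => /andP[/eqP -> /eqP ->].
Qed.

Lemma normsq_scale_delta c x f : normsq (c *: delta x * f) =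
  (complex.Re c ^+ 2 + complex.Im c ^+ 2) * normsq f.
Proof.
have delta1 : delta 1%g = 1 by apply: ga_P => y;
  rewrite ga_deltaE -(ga_oneE R[i] y).
rewrite ga_starM ga_star_scale_delta -!mulrA -!scalerAl -!scalerAr !scalerA.
rewrite [delta x^-1%g * _]mulrA ga_deltaM mulVg delta1 mul1r /ga_re_trace
  ga_scaleE.
by case: c => a b; case: (coef _ _) => u v /=; ring.
Qed.

(** Each scaled group element multiplies the norm by a constant, and bounded
    elements are closed under addition by the parallelogram identity. *)
Lemma normsq_bounded f : bounded_left_mul ga_star ga_re_trace f.
Proof.
rewrite [f]ga_sum_delta; elim/big_ind: _ => [|f1 f2|].
  by exists 0 => h; rewrite !mul0r raddf0 mul0r raddf0.
  exact/bounded_left_mulD/normsq_ge0.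
move=> x _; exists (complex.Re (coef f x) ^+ 2 + complex.Im (coef f x) ^+ 2) =>
  h.
by rewrite [leLHS]normsq_scale_delta.
Qed.

Lemma group_algebra_idempotent_trace0 (e : CG) :
  e * e = e -> coef e 1%g = 0 -> e = 0.
Proof.
move=> ee e1; apply: (idempotent_trace0 (star := ga_star) (tr := ga_re_trace))
  => //.
- exact: ga_starM.
- exact: ga_starK.
- exact: ga_re_traceC.
- exact: ga_re_trace_star.
- exact: normsq_ge0.
- exact: normsq_eq0.
- by move=> f; apply: le_trans (normsq_ge_coef f 1%g); rewrite lerDl sqr_ge0.
- exact: normsq_bounded.
- by rewrite /= /ga_re_trace e1.
Qed.

Lemma no_nontrivial_idempotent (e : CG) :
    power_conjugate_trivial G ->
  e * e = e -> e = 0 \/ e = 1.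
Proof.
move=> noconj ee.
have [e1|e1] := idempotent_coef1 noconj (pchar_num R[i]) ee.
  by left; apply: group_algebra_idempotent_trace0.
right; apply/eqP; rewrite eq_sym -subr_eq0; apply/eqP.
apply: group_algebra_idempotent_trace0.
  by rewrite mulrBl mul1r mulrBr mulr1 ee subrr subr0.
by rewrite ga_addE ga_oppE e1 [X in X - _](ga_oneE R[i] 1%g) eqxx subrr.
Qed.

End GroupAlgebraStar.

(** * Matrices conjugate to a proper power *)

Section PowerConjugateMatrices.
Variables (C : fieldType) (n : nat).
Implicit Types T x h : 'M[C]_n.+1.

Lemma mul_trig_mx T x : is_trig_mx T -> is_trig_mx x ->
  is_trig_mx (T * x) /\ forall i, (T * x) i i = T i i * x i i.
Proof.
move=> /is_trig_mxP T0 /is_trig_mxP x0; split=> [|i].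
  apply/is_trig_mxP => i j ij; rewrite mxE big1 // => k _.
  have [ik|ki] := ltnP i k; first by rewrite T0 // mul0r.
  by rewrite [x k j]x0 ?mulr0 // (leq_ltn_trans ki).
rewrite mxE (bigD1 i) //= big1 ?addr0 // => k /negPf ki.
have [ik|] := ltnP i k; first by rewrite T0 // mul0r.
by rewrite leq_eqVlt val_eqE ki => /x0 ->; rewrite mulr0.
Qed.

Lemma exp_trig_mx T k : is_trig_mx T ->
  is_trig_mx (T ^+ k) /\ forall i, (T ^+ k) i i = T i i ^+ k.
Proof.
move=> T0; elim: k => [|k [Tk0 Tkii]].
  by split=> [|i]; rewrite expr0 ?scalar_mx_is_trig // mxE eqxx.
rewrite exprS; have [? TTk] := mul_trig_mx T0 Tk0; split=> // i.
by rewrite TTk Tkii exprS.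
Qed.

Lemma eigenvalue_trig_mx T a : is_trig_mx T ->
  eigenvalue T a -> exists i, a = T i i.
Proof.
move=> T0; rewrite eigenvalue_root_char char_poly_trig //.
rewrite -(big_map (fun i => T i i) predT (fun c => 'X - c%:P)).
by rewrite root_prod_XsubC => /mapP[i _ ->]; exists i.
Qed.

Lemma eigenvalue_diag_trig_mx T i : is_trig_mx T -> eigenvalue T (T i i).
Proof.
move=> T0; rewrite eigenvalue_root_char char_poly_trig //.
rewrite -(big_map (fun i => T i i) predT (fun c => 'X - c%:P)) root_prod_XsubC.
by apply/mapP; exists i; rewrite ?mem_index_enum.
Qed.

Lemma eigenvalueX x a k : eigenvalue x a -> eigenvalue (x ^+ k) (a ^+ k).
Proof.
move=> /eigenvalueP[v vx v0]; apply/eigenvalueP; exists v => //.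
elim: k => [|k IHk]; first by rewrite !expr0 mulmx1 scale1r.
by rewrite exprSr mulmxA IHk -scalemxAl vx scalerA exprSr.
Qed.

Lemma eigenvalue_conj x y h a : h \in unitmx -> h *m x = y *m h ->
  eigenvalue y a -> eigenvalue x a.
Proof.
move=> hU hx /eigenvalueP[v vy v0]; apply/eigenvalueP; exists (v *m h).
  by rewrite -mulmxA hx mulmxA vy scalemxAl.
by apply: contraNneq v0 => /(congr1 (mulmx^~ (invmx h)));
  rewrite mul0mx mulmxK // => ->.
Qed.

(** The q-th power of an eigenvalue of x is an eigenvalue of x ^+ q, hence of
    its conjugate x. Iterating, an eigenvalue a satisfies a ^+ (q ^ i) = a ^+
    (q ^ j) for some i < j, and a is nonzero. *)
Lemma power_conj_root_of_unity T x P h q i : is_trig_mx T -> x \in unitmx ->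
    P \in unitmx -> P *m x = T *m P ->
    h \in unitmx -> (1 < q)%N -> h *m x ^+ q = x *m h ->
  exists2 m, (0 < m)%N & T i i ^+ m = 1.
Proof.
move=> T0 xU PU PxT hU q1 hx.
have PxT' : invmx P *m T = x *m invmx P.
  by apply: (can_inj (mulmxK PU));
    rewrite mulmxKV // -mulmxA -PxT mulmxA mulVmx ?mul1mx.
have hx' : invmx h *m x = x ^+ q *m invmx h.
  by apply: (can_inj (mulmxK hU));
    rewrite mulmxKV // -mulmxA -hx mulmxA mulVmx ?mul1mx.
have invU A : (A : 'M[C]_n.+1) \in unitmx -> invmx A \in unitmx by rewrite
  unitmx_inv.
have next j : exists j', T j' j' = T j j ^+ q.
  suff /(eigenvalue_trig_mx T0)[j' ->] : eigenvalue T (T j j ^+ q) by exists j'.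
  apply: (eigenvalue_conj (invU _ PU) PxT').
  apply: (eigenvalue_conj (invU _ hU) hx'); apply: eigenvalueX.
  by apply: (eigenvalue_conj PU PxT); apply: eigenvalue_diag_trig_mx.
have [N NE] := choice next.
have iterN k : T (iter k N i) (iter k N i) = T i i ^+ (q ^ k).
  by elim: k => [|k IHk]; rewrite ?expr1 //= NE IHk -exprM expnSr.
have inS k : iter k N i \in enum 'I_n.+1 by rewrite mem_enum.
have [a [b [ab Nab]]] := iter_repeats inS.
have Ti0 : T i i != 0.
  have : \det T != 0.
    have /(congr1 determinant) := PxT;
      rewrite !det_mulmx mulrC => /(mulIf _) <-.
      by rewrite -unitfE -unitmxE.
    by rewrite -unitfE -unitmxE.
  by rewrite det_trig // prodf_seq_neq0 => /allP/(_ i (mem_index_enum i)).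
exists (q ^ b - q ^ a)%N; first by rewrite subn_gt0 ltn_exp2l.
apply: (mulfI (expf_neq0 (q ^ a) Ti0)).
by rewrite mulr1 -exprD subnKC ?leq_exp2l ?(ltnW ab) // -!iterN Nab.
Qed.

End PowerConjugateMatrices.

Lemma power_conj_virtually_unipotent (C : numClosedFieldType) n
    (x h : 'M[C]_n.+1) q :
    x \in unitmx -> h \in unitmx -> (1 < q)%N -> h *m x ^+ q = x *m h ->
  exists m (P T : 'M[C]_n.+1), [/\ (0 < m)%N, P \in unitmx, is_trig_mx T,
    forall i, T i i = 1 & P *m x ^+ m = T *m P].
Proof.
move=> xU hU q1 hx; have [P /unitarymx_unit PU Ptrig] := Schur x (ltn0Sn n).
pose T := conjmx P x; have T0 : is_trig_mx T by [].
have PxT : P *m x = T *m P by rewrite /T conjumx // mulmxKV.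
have ord i : exists m, (0 < m)%N /\ T i i ^+ m = 1.
  by have [m] := power_conj_root_of_unity i T0 xU PU PxT hU q1 hx; exists m.
have [N NE] := choice ord.
exists (\prod_i N i)%N, P, (T ^+ (\prod_i N i)); split=> //.
- by rewrite prodn_gt0 // => i; case: (NE i).
- by case: (exp_trig_mx (\prod_i N i)%N T0).
- move=> i; case: (exp_trig_mx (\prod_i N i)%N T0) => _ ->.
  by rewrite (bigD1 i) //= exprM; case: (NE i) => _ ->; rewrite expr1n.
elim: (\prod_i N i)%N => [|k IHk]; first by rewrite !expr0 mulmx1 mul1mx.
by rewrite !exprSr mulmxA IHk -mulmxA PxT mulmxA.
Qed.

(** * Limits in SL(n, K) *)

Local Open Scope classical_set_scope.

Section MatrixLimits.
Variables (K : numFieldType) (X : Type) (F : set_system X).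
Context {FF : Filter F}.

Lemma cvg_mx_entries m n (f : X -> 'M[K]_(m, n)) (M : 'M[K]_(m, n)) :
  (forall i j, f x i j @[x --> F] --> M i j) -> f x @[x --> F] --> M.
Proof.
move=> fM A [P MP PA].
apply: (filterS (P := [set x | forall i j, P i j (f x i j)])).
  by move=> x; apply: PA.
apply: filter_forall => i; apply: filter_forall => j; exact: fM.
Qed.

Lemma cvg_mx_coord m n (f : X -> 'M[K]_(m, n)) (M : 'M[K]_(m, n)) i j :
  f x @[x --> F] --> M -> f x i j @[x --> F] --> M i j.
Proof.
move=> fM.
apply: (cvg_comp f (fun N : 'M[K]_(m, n) => N i j) fM). exact: coord_continuous.
Qed.

Lemma cvg_mulmx m n p (f : X -> 'M[K]_(m, n)) (g : X -> 'M[K]_(n, p))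
    (M : 'M[K]_(m, n)) (N : 'M[K]_(n, p)) :
  f x @[x --> F] --> M -> g x @[x --> F] --> N ->
  f x *m g x @[x --> F] --> M *m N.
Proof.
move=> fM gN; apply: cvg_mx_entries => i j; rewrite mxE.
under eq_cvg do rewrite mxE.
apply: cvg_big => [|k _]; first exact: add_continuous.
by apply: cvgM; apply: cvg_mx_coord.
Qed.

Lemma cvg_det n (f : X -> 'M[K]_n) (M : 'M[K]_n) :
  f x @[x --> F] --> M -> \det (f x) @[x --> F] --> \det M.
Proof.
move=> fM; apply: cvg_big => [|s _]; first exact: add_continuous.
apply: cvgM; first exact: cvg_cst.
apply: cvg_big => [|i _]; first exact: mul_continuous.
exact: cvg_mx_coord.
Qed.

Lemma cvg_adjugate n (f : X -> 'M[K]_n) (M : 'M[K]_n) :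
  f x @[x --> F] --> M -> \adj (f x) @[x --> F] --> \adj M.
Proof.
move=> fM; apply: cvg_mx_entries => i j; rewrite mxE.
under eq_cvg do rewrite mxE.
apply: cvgM; first exact: cvg_cst.
apply: cvg_det; apply: cvg_mx_entries => k l; rewrite !mxE.
under eq_cvg do rewrite !mxE.
exact: cvg_mx_coord.
Qed.

Lemma cvg_SL n (f : X -> special_linear n K) (a : special_linear n K) :
  (SLval (f x) : 'M[K]_n) @[x --> F] --> (SLval a : 'M[K]_n) ->
  f x @[x --> F] --> a.
Proof.
move=> fa A [B [[U oU <-] Ua] BA].
apply: (filterS (P := [set x | U (SLval (f x))])); first by move=> x; apply: BA.
by apply: fa; apply: open_nbhs_nbhs.
Qed.

Lemma cvg_SLval n (f : X -> special_linear n K) (a : special_linear n K) :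
  f x @[x --> F] --> a ->
  (SLval (f x) : 'M[K]_n) @[x --> F] --> (SLval a : 'M[K]_n).
Proof.
move=> fa.
by apply: (cvg_comp f (@SLval n K) fa); apply: initial_continuous.
Qed.

Lemma cvg_SL_mul n (f g : X -> special_linear n K) (a b : special_linear n K) :
  f x @[x --> F] --> a -> g x @[x --> F] --> b ->
  (f x * g x)%g @[x --> F] --> (a * b)%g.
Proof.
move=> fa gb; apply: cvg_SL.
by apply: cvg_mulmx; apply: cvg_SLval.
Qed.

(** On matrices of determinant 1 inversion is the adjugate, which is
    polynomial in the entries. *)
Lemma cvg_SL_inv n (f : X -> special_linear n K) (a : special_linear n K) :
  f x @[x --> F] --> a -> (f x)^-1%g @[x --> F] --> a^-1%g.
Proof.
have invE (b : special_linear n K) : SLval b^-1%g = \adj b.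
  by rewrite /= /invmx SL_unitmx det_SL invr1 scale1r.
move=> fa; apply: cvg_SL; rewrite invE; under eq_cvg do rewrite invE.
by apply: cvg_adjugate; apply: cvg_SLval.
Qed.

End MatrixLimits.

(** Conjugation by the diagonal matrix with entries t ^+ i / t ^+ (n - i), of
    determinant 1, multiplies the (i, j) entry of the lower triangular matrix
    T by t ^+ (2 (i - j)). The result is polynomial in t and equal to 1 at t =
    0. *)
Lemma unipotent_conj_cvg1 (K : numFieldType) n (u : special_linear n.+1 K)
    (P T : 'M[K]_n.+1) :
    P \in unitmx -> is_trig_mx T -> (forall i, T i i = 1) ->
    P *m u = T *m P ->
  exists h : K -> special_linear n.+1 K,
    (h t * u * (h t)^-1)%g @[t --> (0 : K)^'] --> (1%g : special_linear n.+1 K).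
Proof.
move=> PU /is_trig_mxP T0 T1 PuT.
pose d (t : K) (i : 'I_n.+1) := t ^+ i / t ^+ rev_ord i.
pose D t := diag_mx (\row_i d t i).
have detD t : t != 0 -> \det (D t) = 1.
  move=> t0; rewrite det_diag.
  under eq_bigr do rewrite mxE /d.
  have rev : \prod_(i < n.+1) t ^+ rev_ord i = \prod_(i < n.+1) t ^+ i.
    by rewrite [RHS](reindex_inj rev_ord_inj).
  rewrite big_split /= prodfV rev divff //.
  by rewrite prodf_seq_neq0; apply/allP => i _; rewrite expf_neq0.
pose H t := invmx P *m D t *m P.
have detH t : t != 0 -> \det (H t) == 1.
  move=> t0; rewrite !det_mulmx detD // mulr1 -det_mulmx mulVmx // det1 //.
(* For t <> 0 this is the matrix H t, and the limit ignores t = 0. *)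
pose h t : special_linear n.+1 K := insubd (1%g : special_linear n.+1 K) (H t).
have hE t : t != 0 -> SLval (h t) = H t by move=> t0;
  rewrite /h val_insubd detH.
exists h; apply: cvg_SL.
(* The subtraction i - j is truncated, but T i j = 0 for i < j. *)
pose phi t := invmx P *m (\matrix_(i, j) (T i j * t ^+ (i - j).*2)) *m P.
have phi0 : phi 0 = 1%:M.
  rewrite /phi (_ : \matrix_(i, j) _ = 1%:M) ?mulmx1 ?mulVmx //.
  apply/matrixP => i j; rewrite !mxE; case: (ltngtP i j) => [ij|ji|ij].
  - by rewrite T0 // mul0r -val_eqE /= ltn_eqF.
  - by rewrite expr0n double_eq0 subn_eq0 leqNgt ji mulr0 -val_eqE /= gtn_eqF.
  by rewrite (val_inj ij) T1 subnn eqxx mul1r.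
have hphi t : t != 0 -> SLval (h t * u * (h t)^-1)%g = phi t.
  move=> t0; have HU : H t \in unitmx by rewrite unitmxE (eqP (detH t t0))
    unitr1.
  rewrite /= hE //; apply: (can_inj (mulmxK HU)); rewrite mulmxKV //.
  rewrite /phi /H !mulmxA mulmxK // -[LHS]mulmxA PuT mulmxA.
  congr (_ *m P); rewrite -!mulmxA; congr (_ *m _).
  apply/matrixP => i j; rewrite mul_diag_mx mul_mx_diag !mxE.
  have [ij|ji] := ltnP i j; first by rewrite T0 // mulr0 !mul0r.
  rewrite mulrC -mulrA; congr (_ * _).
  apply/eqP; rewrite /d mulrA eqr_div ?expf_neq0 // -!exprD; apply/eqP;
    congr (_ ^+ _).
  by rewrite /=; have := ltn_ord i; rewrite -addnn; lia.
apply: (@cvg_trans _ (phi t @[t --> (0 : K)^'])).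
  apply: near_eq_cvg; near=> t; apply/esym/hphi.
  by near: t; apply: nbhs_dnbhs_neq.
rewrite -[SLval _]/(1%:M) -phi0.
have cvg_id0 : t @[t --> (0 : K)^'] --> (0 : K) by apply: cvg_within.
apply: cvg_mulmx; last exact: cvg_cst.
apply: cvg_mulmx; first exact: cvg_cst.
apply: cvg_mx_entries => i j; rewrite mxE; under eq_cvg do rewrite mxE.
apply: cvgM; first exact: cvg_cst.
elim: (i - j).*2 => [|k IHk]; first exact: cvg_cst.
by rewrite exprS; under eq_cvg do rewrite exprS; apply: cvgM.
Unshelve. all: by end_near.
Qed.

(** * Cocompact discrete subgroups *)

Section DiscreteCocompact.
Variables (n : nat) (K : numFieldType) (H : groupClosed (special_linear n K)).
Local Notation SL := (special_linear n K).
Local Notation Q := (quotient_topology (left_cosets H)).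

Lemma left_cosets_pi_eq (x y : SL) :
  (\pi_Q x = \pi_Q y :> Q)%qT <-> (x^-1 * y)%g \in H.
Proof. by split=> [/eqmodP|?]; [|apply/eqmodP]. Qed.

(** The projection to the coset space is open: the saturation of an open set
    is a union of right translates of it. *)
Lemma left_cosets_pi_nbhs (x : SL) (W : set SL) :
  nbhs x W -> nbhs (\pi_Q x : Q)%qT ((\pi_Q : SL -> Q) @` W)%qT.
Proof.
rewrite nbhsE => -[W0 [oW0 W0x] W0W].
have oU : open ((\pi_Q : SL -> Q) @` W0)%qT.
  rewrite /open /= /quotient_open.
  rewrite (_ : _ @^-1` _ = \bigcup_(g in [set` H]) [set y | W0 (y * g)%g]).
    apply: bigcup_open => g _.
    have := @continuousP SL SL (fun y => (y * g)%g); case=> /(_ _ W0 oW0) + _;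
      apply.
    move=> y; apply: (@cvg_SL_mul K SL (nbhs (y : SL)) (nbhs_filter (y : SL))).
      exact: cvg_id.
    exact: cvg_cst.
  apply/seteqP; split=> [y [z W0z /left_cosets_pi_eq zy]|y [g /= gH W0yg]].
    by exists (z^-1 * y)^-1%g => /=;
      rewrite ?gpredV // invgM invgK mulgA mulgV mul1g.
  exists (y * g)%g => //; apply/left_cosets_pi_eq.
  by rewrite invgM -mulgA mulVg mulg1 gpredV.
apply: (filterS (P := ((\pi_Q : SL -> Q) @` W0)%qT)).
  by move=> _ [y W0y <-]; exists y => //; apply: W0W.
by apply: open_nbhs_nbhs; split=> //; exists x.
Qed.

(** By compactness the cosets of the h x cluster at the coset of some y. So
    for suitable x there is g in [H] with h x * g close to y and h x * u * (h
    x)^-1 close to 1, whence the element g^-1 * u * g of [H] is close to 1; by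
    discreteness it equals 1. *)
Lemma cocompact_conj_cvg1 (X : Type) (F : set_system X) (FF : ProperFilter F)
    (u : SL) (h : X -> SL) :
    discrete_subgroup H -> cocompact_subgroup H -> u \in H ->
    (h x * u * (h x)^-1)%g @[x --> F] --> (1%g : SL) ->
  u = 1%g.
Proof.
move=> Hdisc Hcoco uH hu1.
have [q [_ Fq]] := Hcoco ((fun x => \pi_Q (h x) : Q)%qT @ F) _ filterT.
have [_ [V V1 VH]] := Hdisc 1%g (gpred1 : 1%g \in H).
pose y : SL := generic_quotient.repr q.
have piy : (\pi_Q y)%qT = q by rewrite generic_quotient.reprK.
have conj_cvg : (p.1^-1 * p.2 * p.1)%g @[p --> (nbhs y, nbhs (1%g : SL))] -->
    (y^-1 * 1 * y : SL)%g.
  have [Fy F1] := (nbhs_filter (y : SL), nbhs_filter (1%g : SL)).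
  have Fy1 : Filter (filter_prod (nbhs (y : SL)) (nbhs (1%g : SL))).
    exact: filter_prod_filter.
  apply: (cvg_SL_mul (FF := Fy1)); last exact: cvg_fst.
  apply: (cvg_SL_mul (FF := Fy1)); last exact: cvg_snd.
  by apply: (cvg_SL_inv (FF := Fy1)); exact: cvg_fst.
rewrite mulg1 mulVg in conj_cvg.
have [[W W'] [/= yW W'1] WV] := conj_cvg V V1.
have := left_cosets_pi_nbhs yW; rewrite piy => qW.
have FW' : (\pi_Q (h x) @[x --> F])%qT
    [set (\pi_Q (h x) : Q)%qT | x in [set x | W' (h x * u * (h x)^-1)%g]].
  have FU : F [set x | W' (h x * u * (h x)^-1)%g] := hu1 _ W'1.
  by apply: (@filterS _ F _ _ _ _ FU) => x W'x; exists x.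
have [_ [[x /= W'x <-] [z Wz /left_cosets_pi_eq zx]]] := Fq _ _ FW' qW.
have : [set 1%g] (z^-1 * (h x * u * (h x)^-1) * z)%g.
  rewrite -VH; split; first exact: (WV (z, _) (conj Wz W'x)).
  rewrite /= (_ : _ * z = (z^-1 * h x) * u * (z^-1 * h x)^-1)%g.
    by apply: gpredM; [apply: gpredM|rewrite gpredV].
  by rewrite invgM invgK !mulgA.
move=> /= /(congr1 (fun v => (h x)^-1 * (z * v * z^-1) * h x)%g).
by rewrite !mulgA !(mulgKV, mulgK, mulVg, mulgV, mul1g, mulg1).
Qed.
End DiscreteCocompact.

Lemma lattice_power_conjugate_trivial (R : rcfType) (n : nat)
    (Gamma : groupClosed (special_linear n.+1 R[i])) :
    discrete_subgroup Gamma -> cocompact_subgroup Gamma ->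
    torsion_free (subgroup_type Gamma) ->
  power_conjugate_trivial (subgroup_type Gamma).
Proof.
move=> Gdisc Gcoco Gtf x h q q1 xhq.
pose X := val x; pose Y := val h.
have XU := SL_unitmx X; have YU := SL_unitmx Y.
have valX k : SLval (X ^+ k)%g = (SLval X : 'M_n.+1) ^+ k.
  by elim: k => [|k IHk] //; rewrite expgS exprS /= IHk.
have XY : (SLval Y *m (SLval X : 'M_n.+1) ^+ q = SLval X *m SLval Y)%R.
  have : (Y * X ^+ q)%g = (X * Y)%g.
    by rewrite -gmulfXn -!gmulfM -xhq conjgE mulVKg.
  by move=> /(congr1 (@SLval _ _)); rewrite -valX.
have [m [P [T [m0 PU T0 T1]]]] := power_conj_virtually_unipotent XU YU q1 XY.
rewrite -valX => PXT.
apply: (Gtf _ m m0); apply: val_inj; rewrite gmulfXn gmulf1.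
have [g gcvg] := unipotent_conj_cvg1 PU T0 T1 PXT.
apply: cocompact_conj_cvg1 Gdisc Gcoco _ gcvg.
by rewrite -gmulfXn; apply: valP.
Qed.

Theorem corollary62 (R : realType) (n : nat) (hn : (2 <= n)%N)
    (Gamma : groupClosed (special_linear n R[i]))
    (Gamma_discrete : discrete_subgroup Gamma)
    (Gamma_cocompact : cocompact_subgroup Gamma)
    (Gamma_torsion_free : torsion_free (subgroup_type Gamma))
    (e : group_algebra R[i] (subgroup_type Gamma)) (he : e * e = e) :
  e = 0 \/ e = 1.
Proof.
case: n hn Gamma Gamma_discrete Gamma_cocompact Gamma_torsion_free e he => //.
move=> n _ Gamma Gdisc Gcoco Gtf e; apply: no_nontrivial_idempotent.
exact: lattice_power_conjugate_trivial.
Qed.
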